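(* The generating function for partitions whose Young diagram fits inside a square with respect to the side length of the square and the statistic $\mathrm{ds}^\Box_n$ is $$\sum_{n\ge0} \sum_{\lambda\in\mathcal P^\Box_n} s^{\mathrm{ds}^\Box_n(\lambda)} z^n = \frac{1}{2(1-s)z + \sqrt{1-4z}}.$$
   Context: An integer partition is a sequence $\lambda=(\lambda_1,\dots,\lambda_k)$ with $k\ge0$ and $\lambda_1\ge\dots\ge\lambda_k\ge1$ (the empty partition is allowed). For $n\ge0$, $\mathcal P^\Box_n$ is the set of partitions with $k\le n$ parts and $\lambda_1\le n$, i.e. whose Young diagram fits inside an $n\times n$ square. For $\lambda\in\mathcal P^\Box_n$, let $\tilde\lambda=(\lambda_1,\dots,\lambda_k,0,\dots,0)$ be the sequence of length $n$ obtained by appending $n-k$ zeros, and let $\tilde\lambda'$ be the sequence of length $n$ with entries $\tilde\lambda'_i=|\{j:\tilde\lambda_j\ge i\}|$ for $1\le i\le n$. Define $\mathrm{ds}^\Box_n(\lambda)=|\{i\in\{1,\dots,n\}:\tilde\lambda_i=\tilde\lambda'_i\}|$ (zeros may contribute). The identity is between formal power series in $z$ with coefficients polynomials in $s$, with $\sqrt{1-4z}$ having constant term $1$. *)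

(* Defs.v *)
From HB Require Import structures.
From mathcomp Require Import all_boot all_order all_algebra.
From mathcomp Require Import boolp.

Set Implicit Arguments.
Unset Strict Implicit.
Unset Printing Implicit Defensive.

Import GRing.Theory.

Definition is_partition (la : seq nat) : bool := sorted geq la && (0 \notin la).

(* A sequence of at most n parts, each at most n, is an n.-bseq 'I_n.+1, which
   makes the set of partitions fitting in the n x n square a finite set; see
   square_partitionsP and square_parts_inj. *)
Definition square_parts n (la : n.-bseq 'I_n.+1) : seq nat := map val la.

Definition square_partitions n : {set n.-bseq 'I_n.+1} :=
  [set la | is_partition (square_parts la)].

Lemma square_parts_inj n : injective (@square_parts n).
Proof. by move=> a b /(inj_map val_inj) ab; apply: val_inj. Qed.

Lemma square_partitionsP n (la : seq nat) :
  reflect (exists2 b, b \in square_partitions n & square_parts b = la)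
          [&& is_partition la, size la <= n & head 0 la <= n].
Proof.
apply: (iffP and3P) => [[Pla szla hla]|[b]]; last first.
  rewrite inE => Pb <-; split=> //; first by rewrite size_map size_bseq.
  by rewrite /square_parts; case: (bseqval b) => [|x s] //=; rewrite -ltnS.
have le_n : {in la, forall x, x < n.+1}.
  have /andP[+ _] := Pla; case: la hla {Pla szla} => [|x s] //= xn.
  move/(order_path_min (rev_trans leq_trans))/allP => sx y.
  rewrite inE => /predU1P[-> //|/sx yx].
  by rewrite ltnS; apply: leq_trans xn.
have sz : size (map inord la : seq 'I_n.+1) <= n by rewrite size_map.
have vE : map val (map inord la : seq 'I_n.+1) = la.
  by rewrite -map_comp -[RHS]map_id; apply/eq_in_map=> x /le_n xn /=; rewrite inordK.
by exists (Bseq sz); rewrite ?inE /square_parts /= vE.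
Qed.

Definition pad (n : nat) (la : seq nat) : seq nat := la ++ nseq (n - size la) 0.

Definition padded_conj (n : nat) (la : seq nat) : seq nat :=
  mkseq (fun i => count (fun x => i.+1 <= x) (pad n la)) n.

Definition ds_square (n : nat) (la : seq nat) : nat :=
  #|[set i : 'I_n | nth 0 (pad n la) i == nth 0 (padded_conj n la) i]|.

Local Open Scope ring_scope.

(* Fps a is the formal power series \sum_n a n z^n. *)
Record fps (R : Type) := Fps { fps_coef : nat -> R }.

Lemma fpsP (R : Type) (f g : fps R) : fps_coef f =1 fps_coef g -> f = g.
Proof. by case: f g => [f] [g] /= /funext ->. Qed.

(* The list of the first n terms of the sequence u with
   u n = F [:: u 0; ...; u n.-1]. *)
Fixpoint hist (R : Type) (F : seq R -> R) (n : nat) : seq R :=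
  if n is m.+1 then rcons (hist F m) (F (hist F m)) else [::].

Lemma histE (R : Type) (F : seq R -> R) n :
  hist F n = mkseq (fun i => F (hist F i)) n.
Proof. by elim: n => // n IHn; rewrite mkseqS /= [in LHS]IHn -IHn. Qed.

Lemma size_hist (R : Type) (F : seq R -> R) n : size (hist F n) = n.
Proof. by rewrite histE size_mkseq. Qed.

Lemma nth_hist (R : Type) (F : seq R -> R) x0 n i :
  (i < n)%N -> nth x0 (hist F n) i = F (hist F i).
Proof. by move=> lt_in; rewrite histE nth_mkseq. Qed.

HB.instance Definition _ (R : Type) := gen_eqMixin (fps R).
HB.instance Definition _ (R : Type) := gen_choiceMixin (fps R).

Section FpsZmod.
Variable R : zmodType.
Implicit Types f g h : fps R.

Definition fps0 : fps R := Fps (fun=> 0).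
Definition fps_opp f := Fps (fun n => - fps_coef f n).
Definition fps_add f g := Fps (fun n => fps_coef f n + fps_coef g n).

Lemma fps_addA : associative fps_add.
Proof. by move=> f g h; apply: fpsP => n /=; rewrite addrA. Qed.
Lemma fps_addC : commutative fps_add.
Proof. by move=> f g; apply: fpsP => n /=; rewrite addrC. Qed.
Lemma fps_add0 : left_id fps0 fps_add.
Proof. by move=> f; apply: fpsP => n /=; rewrite add0r. Qed.
Lemma fps_addN : left_inverse fps0 fps_opp fps_add.
Proof. by move=> f; apply: fpsP => n /=; rewrite addNr. Qed.

HB.instance Definition _ :=
  GRing.isZmodule.Build (fps R) fps_addA fps_addC fps_add0 fps_addN.

End FpsZmod.

Section FpsRing.
Variable R : comNzRingType.
Implicit Types f g h : fps R.

Definition fpsC (c : R) : fps R := Fps (fun n => if n == 0%N then c else 0).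
Definition fpsX : fps R := Fps (fun n => (n == 1%N)%:R).

Definition fps_mul f g :=
  Fps (fun n => \sum_(i < n.+1) fps_coef f i * fps_coef g (n - i)).

Definition fps_trunc n f : {poly R} := \poly_(i < n) fps_coef f i.

Lemma coef_fps_mul f g m n : (n < m)%N ->
  fps_coef (fps_mul f g) n = (fps_trunc m f * fps_trunc m g)`_n.
Proof.
move=> lt_nm; rewrite coefM; apply: eq_bigr => i _; rewrite !coef_poly.
have le_in : (i <= n)%N by rewrite -ltnS.
by rewrite (leq_ltn_trans le_in lt_nm) (leq_ltn_trans (leq_subr _ _) lt_nm).
Qed.

Lemma fps_mulC : commutative fps_mul.
Proof.
by move=> f g; apply: fpsP => n; rewrite !(coef_fps_mul _ _ (ltnSn n)) mulrC.
Qed.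

Lemma fps_mulA : associative fps_mul.
Proof.
move=> f g h; apply: fpsP => n.
transitivity (fps_trunc n.+1 f * (fps_trunc n.+1 g * fps_trunc n.+1 h))`_n.
  rewrite coefM; apply: eq_bigr => i _; rewrite coef_poly ltn_ord.
  by congr (_ * _); apply: coef_fps_mul; rewrite ltnS leq_subr.
rewrite mulrA coefM; apply: eq_bigr => i _.
by rewrite coef_poly ltnS leq_subr (coef_fps_mul _ _ (ltn_ord i)).
Qed.

Lemma fps_mul1 : left_id (fpsC 1) fps_mul.
Proof.
move=> f; apply: fpsP => n /=; rewrite big_ord_recl /= mul1r subn0.
by rewrite big1 ?addr0 // => i _; rewrite mul0r.
Qed.

Lemma fps_mulDl : left_distributive fps_mul (@fps_add R).
Proof.
move=> f g h; apply: fpsP => n /=; rewrite -big_split.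
by apply: eq_bigr => i _; rewrite mulrDl.
Qed.

Lemma fps1_neq0 : fpsC 1 != fps0 R.
Proof.
by apply/eqP => /(congr1 (fun f => fps_coef f 0)) /eqP /=; rewrite oner_eq0.
Qed.

HB.instance Definition _ := GRing.Zmodule_isComNzRing.Build (fps R)
  fps_mulA fps_mulC fps_mul1 fps_mulDl fps1_neq0.

Lemma fps_coef0 n : fps_coef (0 : fps R) n = 0. Proof. by []. Qed.
Lemma fps_coef1 n : fps_coef (1 : fps R) n = (n == 0%N)%:R.
Proof. by rewrite /=; case: eqP. Qed.
Lemma fps_coefD f g n : fps_coef (f + g) n = fps_coef f n + fps_coef g n.
Proof. by []. Qed.
Lemma fps_coefN f n : fps_coef (- f) n = - fps_coef f n. Proof. by []. Qed.
Lemma fps_coefB f g n : fps_coef (f - g) n = fps_coef f n - fps_coef g n.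
Proof. by []. Qed.
Lemma fps_coefM f g n :
  fps_coef (f * g) n = \sum_(i < n.+1) fps_coef f i * fps_coef g (n - i).
Proof. by []. Qed.
Lemma fps_coefMn f k n : fps_coef (f *+ k) n = fps_coef f n *+ k.
Proof. by elim: k => // k IHk; rewrite !mulrS fps_coefD IHk. Qed.

End FpsRing.

Section FpsUnitRing.
Variable R : comUnitRingType.
Implicit Types f g h : fps R.

Definition fps_unit : {pred fps R} :=
  fun f => fps_coef f 0 \is a GRing.unit.

(* u n = (1_(n = 0) - \sum_(i < n) u i * f (n - i)) / f 0 *)
Definition fps_inv_step f (u : seq R) : R :=
  ((size u == 0%N)%:R - \sum_(i < size u) u`_i * fps_coef f (size u - i))
    / fps_coef f 0.

Definition fps_inv f : fps R :=
  if f \in fps_unit then Fps (fun n => fps_inv_step f (hist (fps_inv_step f) n))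
  else f.

Lemma fps_mulVf : {in fps_unit, left_inverse 1 fps_inv *%R}.
Proof.
move=> f Uf; apply: fpsP => n; rewrite /fps_inv Uf fps_coef1 fps_coefM /=.
rewrite big_ord_recr /= subnn {2}/fps_inv_step.
rewrite mulrVK // size_hist.
under [X in _ + (_ - X)]eq_bigr => i _ do rewrite nth_hist //.
by rewrite addrC subrK.
Qed.

Lemma fps_unitPl f g : g * f = 1 -> fps_unit f.
Proof.
move/(congr1 (fun h => fps_coef h 0)); rewrite fps_coefM big_ord1 /= => gf1.
by apply/unitrPr; exists (fps_coef g 0); rewrite mulrC.
Qed.

Lemma fps_invr_out : {in [predC fps_unit], fps_inv =1 id}.
Proof. by move=> f; rewrite inE /= /fps_inv => /negbTE ->. Qed.

HB.instance Definition _ := GRing.ComNzRing_hasMulInverse.Build (fps R)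
  fps_mulVf fps_unitPl fps_invr_out.

Lemma fps_unitE f : (f \is a GRing.unit) = (fps_coef f 0 \is a GRing.unit).
Proof. by []. Qed.

(* The square root with constant term 1 of a series with constant term 1, in
   a ring where 2 is invertible:
   u 0 = 1 and u n = (f n - \sum_(0 < i < n) u i * u (n - i)) / 2. *)
Definition fps_sqrt_step f (u : seq R) : R :=
  if size u == 0%N then 1 else
  (fps_coef f (size u) - \sum_(1 <= i < size u) u`_i * u`_(size u - i)) / 2%:R.

Definition fps_sqrt f : fps R :=
  Fps (fun n => fps_sqrt_step f (hist (fps_sqrt_step f) n)).

Lemma fps_sqrt_coef0 f : fps_coef (fps_sqrt f) 0 = 1.
Proof. by []. Qed.

Lemma fps_sqrt_coefS f n : fps_coef (fps_sqrt f) n.+1 =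
  (fps_coef f n.+1 - \sum_(0 <= i < n)
     fps_coef (fps_sqrt f) i.+1 * fps_coef (fps_sqrt f) (n.+1 - i.+1)) / 2%:R.
Proof.
rewrite [LHS]/= -[rcons _ _]/(hist (fps_sqrt_step f) n.+1).
rewrite {1}/fps_sqrt_step size_hist [_ == _]/=.
apply: (congr1 (fun x => (_ - x) / _)); rewrite big_add1 /= !big_nat.
apply: eq_bigr => i /andP[_ lt_in].
rewrite -!/(hist (fps_sqrt_step f) _.+1) !nth_hist // ?ltnS //.
by rewrite subSS leq_subr.
Qed.

Lemma fps_sqrtK f : (2%:R : R) \is a GRing.unit -> fps_coef f 0 = 1 ->
  fps_sqrt f ^+ 2 = f.
Proof.
move=> U2 f0; apply: fpsP => -[|n]; rewrite expr2 fps_coefM.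
  by rewrite big_ord1 /= mulr1 f0.
rewrite -(big_mkord xpredT
  (fun i => fps_coef (fps_sqrt f) i * fps_coef (fps_sqrt f) (n.+1 - i))).
rewrite big_nat_recr // big_nat_recl // subnn subn0 fps_sqrt_coef0 mul1r mulr1.
set s := \big[_/_]_(_ <= _ < _) _.
have -> : fps_coef (fps_sqrt f) n.+1 = (fps_coef f n.+1 - s) / 2%:R.
  exact: fps_sqrt_coefS.
rewrite [LHS]addrAC -mulr2n -[X in X + _]mulr_natr mulrVK //.
by rewrite subrK.
Qed.

Lemma fps_sqrt_unique f g :
  (2%:R : R) \is a GRing.unit -> fps_coef f 0 = 1 ->
  fps_coef g 0 = 1 -> g ^+ 2 = f -> g = fps_sqrt f.
Proof.
move=> U2 f0 g0 g2; apply/eqP; rewrite -subr_eq0.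
have U : g + fps_sqrt f \is a GRing.unit.
  by rewrite fps_unitE fps_coefD g0 fps_sqrt_coef0.
by rewrite -(mulIr_eq0 _ (mulIr U)) -subr_sqr g2 fps_sqrtK // subrr.
Qed.

End FpsUnitRing.

Lemma polyrat2_unit : (2%:R : {poly rat}) \is a GRing.unit.
Proof. by rewrite -(rmorph_nat polyC) poly_unitE size_polyC coefC. Qed.

Lemma sqrt_1B4z (z := fpsX {poly rat}) :
  fps_sqrt (1 - 4%:R * z) ^+ 2 = 1 - 4%:R * z.
Proof.
apply: fps_sqrtK; first exact: polyrat2_unit.
by rewrite mulr_natl fps_coefB fps_coefMn /= mul0rn subr0.
Qed.

Lemma denominator_unit (c : {poly rat}) (f := 1 - 4%:R * fpsX {poly rat}) :
  2%:R * fpsC c * fpsX _ + fps_sqrt f \is a GRing.unit.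
Proof.
by rewrite fps_unitE fps_coefD fps_coefM big_ord1 /= mulr0 add0r unitr1.
Qed.

(* Main.v *)
(* Read the boundary of the diagram of la in the n x n square from the top right
   corner: the parts are the numbers of horizontal steps after each vertical one.
   Fold this word of length 2n at the main diagonal: a is its first half, and b
   is the first half of the boundary of the conjugate.  The boundary ends at the
   opposite corner iff a and b contain equally many vertical steps, i.e. iff the
   walk with steps a_k - b_k, started on the diagonal, ends at 0.  The rows i with
   la_i = la'_i correspond to the level steps (a_k = b_k) of this walk at height 0:
   those above the diagonal to pairs of vertical steps, those below to pairs of
   horizontal steps.

   Let W_h be the generating series of the walks from 0 to h, with weight s for
   each level step at height 0.  The last step gives W_0 = 1 + z (2 s W_0 + 2 W_1)
   and W_h = z (W_(h-1) + 2 W_h + W_(h+1)) for h > 0, which determine all W_h.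
   The solution is W_h = W_0 q^h, where q = z (1 + q)^2, that is,
   2 z q = 1 - 2 z - sqrt (1 - 4 z). *)

Require Import Defs.
From mathcomp Require Import all_boot all_order all_algebra.
From mathcomp Require Import zify ring.

Set Implicit Arguments.
Unset Strict Implicit.
Unset Printing Implicit Defensive.

Import GRing.Theory.

(** * Boundary words and weakly decreasing sequences *)

(* [true] is a vertical step and [false] a horizontal one. *)
Fixpoint area_seq (w : seq bool) : seq nat :=
  if w is x :: w' then
    if x then count negb w' :: area_seq w' else area_seq w'
  else [::].

Lemma size_area_seq w : size (area_seq w) = count id w.
Proof. by elim: w => //= -[] w /= ->. Qed.

Lemma area_seq_le w : all (fun x => x <= count negb w) (area_seq w).
Proof.
elim: w => //= -[] w IHw /=; first by rewrite add0n leqnn.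
by apply: sub_all IHw => x /leq_trans; apply; rewrite leq_addl.
Qed.

Lemma area_seq_sorted w : sorted geq (area_seq w).
Proof.
elim: w => //= -[] w IHw //=.
rewrite (path_sortedE (rev_trans leq_trans)) IHw andbT.
exact: area_seq_le.
Qed.

Lemma count_id_negb w : count id w + count negb w = size w.
Proof. exact: count_predC. Qed.

Lemma area_seq_inj u v : size u = size v -> area_seq u = area_seq v -> u = v.
Proof.
(* If the first letters differ, the tail [v'] has one vertical step more than [u'], hence one
   horizontal step fewer: too few for the entry [count negb u']. *)
have cross u' v' : size u' = size v' -> count negb u' :: area_seq u' <> area_seq v'.
  move=> szE KE; have := congr1 size KE; rewrite /= !size_area_seq => cE.
  have := area_seq_le v'; rewrite -KE /= => /andP[+ _].
  have := count_id_negb u'; have := count_id_negb v'; rewrite -szE; lia.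
elim: u v => [|x u IHu] [|y v] //= [szE]; case: x y => -[] //= KE.
- by case: KE => _ /(IHu _ szE) ->.
- by case: (cross _ _ szE KE).
- by case: (cross v u); rewrite ?szE ?KE.
- by rewrite (IHu v).
Qed.

Lemma area_seq_surj (s : seq nat) k : sorted geq s -> all (fun x => x <= k) s ->
  exists w, [/\ count id w = size s, count negb w = k & area_seq w = s].
Proof.
elim: s k => [|x s IHs] k /=.
  move=> _ _; exists (nseq k false); split.
  - by rewrite count_nseq.
  - by rewrite count_nseq mul1n.
  - by elim: k.
rewrite (path_sortedE (rev_trans leq_trans)) => /andP[sx srt] /andP[xk _].
have [w [c1 c2 Kw]] := IHs x srt sx.
(* The [k - x] leading horizontal steps leave exactly [x] to follow the vertical step of the part
   [x]. *)
exists (nseq (k - x) false ++ true :: w); split.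
- by rewrite count_cat count_nseq /= c1.
- by rewrite count_cat count_nseq /= c2 mul1n add0n subnK.
- by elim: (k - x) => //=; rewrite c2 Kw.
Qed.

Lemma area_seq_cat u v :
  area_seq (u ++ v) = map (addn (count negb v)) (area_seq u) ++ area_seq v.
Proof. by elim: u => //= -[] u -> //=; rewrite count_cat addnC. Qed.

(** * Conjugation of boundary words *)

Lemma count_negb_map w : count negb (map negb w) = count id w.
Proof. by rewrite count_map; apply: eq_count => -[]. Qed.

Lemma count_id_map w : count id (map negb w) = count negb w.
Proof. by rewrite count_map; apply: eq_count => -[]. Qed.

(** Reflection in the diagonal reverses the boundary and swaps the two kinds of steps. A final
    vertical step adds a zero part, which no column sees; a final horizontal step lengthens every
    row, so the conjugate gains a first entry equal to the number of rows. *)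
Lemma area_seq_conj w :
  mkseq (fun i => count (fun x => i.+1 <= x) (area_seq w)) (count negb w)
  = area_seq (rev (map negb w)).
Proof.
elim/last_ind: w => // w x IHw.
rewrite -cats1 map_cat rev_cat /= area_seq_cat count_cat /=.
rewrite count_rev count_negb_map -IHw.
case: x => /=; rewrite !addn0 ?addn1.
  apply: eq_mkseq => i; rewrite count_cat /= addn0 count_map addn0.
  exact: eq_count.
rewrite cats0 /mkseq /= count_map.
congr (_ :: _).
  by rewrite -size_area_seq; apply/eqP; rewrite -all_count; apply/allP.
rewrite -[1]/(0.+1) (iotaDl 1 0) -map_comp; apply: eq_map => i /=.
by rewrite count_map; apply: eq_count => y /=; rewrite !add1n ltnS.
Qed.

(** Both sides have one entry per horizontal step of [w]: the left one counts the vertical steps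
    before it, [area_seq (map negb w)] those after it. *)
Lemma area_seq_rev_negb w :
  area_seq (rev (map negb w))
  = map (subn (count id w)) (rev (area_seq (map negb w))).
Proof.
elim: w => //= x w IHw; rewrite rev_cons -cats1 area_seq_cat {}IHw.
have le_w := area_seq_le (map negb w); rewrite count_negb_map in le_w.
case: x => /=.
  rewrite cats0 -map_comp; apply/eq_in_map => y; rewrite mem_rev => /(allP le_w).
  by move=> /= le_yw; rewrite subSn.
rewrite rev_cons map_rcons !add0n count_negb_map subnn -cats1; congr (_ ++ _).
by rewrite -map_comp; apply: eq_map.
Qed.

(** * Coincidences of two sequences *)

Definition matches (s t : seq nat) : nat := count (fun p => p.1 == p.2) (zip s t).

Lemma matchesC s t : matches s t = matches t s.
Proof.
elim: s t => [|x s IHs] [|y t] //=.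
by rewrite /matches /= eq_sym -!/(matches _ _) IHs.
Qed.

Lemma matches_cat s1 s2 t1 t2 : size s1 = size t1 ->
  matches (s1 ++ s2) (t1 ++ t2) = matches s1 t1 + matches s2 t2.
Proof. by move=> szE; rewrite /matches zip_cat // count_cat. Qed.

Lemma matches_rev s t : size s = size t -> matches (rev s) (rev t) = matches s t.
Proof. by move=> szE; rewrite /matches -rev_zip // count_rev. Qed.

Lemma matches_map f s t : {in s & t, injective f} ->
  matches (map f s) (map f t) = matches s t.
Proof.
elim: s t => [|x s IHs] [|y t] //= injf.
rewrite /matches /= -!/(matches _ _) IHs; last first.
  by move=> u v us vt; apply: injf; rewrite inE ?us ?vt orbT.
congr (nat_of_bool _ + _); apply/eqP/eqP => [|-> //].
by apply: injf; rewrite mem_head.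
Qed.

Lemma matches_rconsl s t v :
  (size s < size t -> nth 0 t (size s) != v) -> matches (rcons s v) t = matches s t.
Proof.
elim: s t => [|x s IHs] [|y t] //=.
  by move=> /(_ isT); rewrite /matches /= eq_sym => /negbTE ->; case: t.
by move=> H; rewrite /matches /= -!/(matches _ _) IHs.
Qed.

Lemma matchesE n s t : size s = n -> size t = n ->
  #|[set i : 'I_n | nth 0 s i == nth 0 t i]| = matches s t.
Proof.
move=> sn tn; rewrite -sum1dep_card big_mkcond /=.
elim: n s t sn tn => [|n IHn] [|x s] [|y t] //=.
  by rewrite big_ord0.
by move=> [sn] [tn]; rewrite big_ord_recl /= IHn //; rewrite /matches /=; case: eqP.
Qed.

(** The entry belongs to the vertical step followed by exactly [i] vertical ones; the left side
    counts all steps after it. *)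
Lemma nth_rev_area_seq w i :
  i < count id w -> nth 0 (rev (area_seq w)) i + i < size w.
Proof.
elim: w => //= -[] w IHw /=; last by rewrite add0n => /IHw /ltnW.
rewrite rev_cons nth_rcons size_rev size_area_seq add1n ltnS leq_eqVlt.
case/predU1P=> [->|iw]; last by rewrite iw ltnW // ltnS IHw.
by rewrite ltnn eqxx ltnS -(count_id_negb w) addnC.
Qed.

(* Reversal aligns the two sequences at the diagonal, so that prolonging the words
   outwards only appends entries. *)
Definition rev_matches a b := matches (rev (area_seq a)) (rev (area_seq b)).

(** A vertical step in front of [a] appends the entry [count negb a] at index [count id a]. If the
    vertical counts agree, two such new entries are aligned and equal. Otherwise the one at the
    smaller index faces an old entry, which is strictly smaller by [nth_rev_area_seq], and the other
    faces nothing. *)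
Lemma rev_matches_cons x a y b : size a = size b ->
  rev_matches (x :: a) (y :: b)
  = [&& x, y & count id a == count id b] + rev_matches a b.
Proof.
move=> szE.
have neq u v : size u = size v -> count id u < count id v ->
    nth 0 (rev (area_seq v)) (count id u) != count negb u.
  move=> uv /nth_rev_area_seq; rewrite -uv -(count_id_negb u); lia.
have cl u v : size u = size v -> rev_matches (true :: u) v = rev_matches u v.
  move=> uv; rewrite /rev_matches /= rev_cons matches_rconsl //.
  by rewrite !size_rev !size_area_seq; apply: neq.
have rC u v : rev_matches u v = rev_matches v u by apply: matchesC.
have ff u v : rev_matches (false :: u) v = rev_matches u v by [].
have tt u v : size u = size v -> count id u < count id v ->
    rev_matches (true :: u) (true :: v) = rev_matches u v.
  move=> uv cuv; rewrite rC /rev_matches /= [rev (_ :: area_seq v)]rev_cons.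
  rewrite matches_rconsl; first by rewrite -/(rev_matches v (true :: u)) rC cl.
  by rewrite !size_rev /= !size_area_seq ltnS leqNgt cuv.
case: x y => -[]; rewrite ?ff //=; first 1 last.
- by rewrite rC ff rC cl.
- by rewrite rC cl // rC.
case: ltngtP => cab; first exact: tt.
  by rewrite rC tt // rC.
rewrite /rev_matches /= !rev_cons -!cats1 matches_cat ?size_rev ?size_area_seq //.
have -> : count negb a = count negb b.
  by apply/eqP; rewrite -(eqn_add2l (count id a)) {2}cab !count_id_negb szE.
by rewrite {2}/matches /= eqxx addnC.
Qed.

(** * Folded boundaries as walks *)

(* The pairs of [t] are listed from the corners of the square to the diagonal. *)
Definition boundary (t : seq (bool * bool)) : seq bool :=
  unzip1 t ++ map negb (rev (unzip2 t)).

Definition ht (t : seq (bool * bool)) : int :=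
  Posz (count id (unzip1 t)) - Posz (count id (unzip2 t)).

(** The walk starts at the end of the list, so [ht t'] is the height at which the step [xy] is
    taken. *)
Fixpoint level_steps0 (t : seq (bool * bool)) : nat :=
  if t is xy :: t' then ((xy.1 == xy.2) && (ht t' == 0%R)) + level_steps0 t' else 0.

Lemma ht_eq0 t : (ht t == 0%R) = (count id (unzip1 t) == count id (unzip2 t)).
Proof. by rewrite subr_eq0. Qed.

(** The first term counts the pairs of vertical steps at height 0, the second those of horizontal
    steps: for words of equal length, the horizontal counts agree iff the vertical ones do. *)
Lemma rev_matches_level_steps0 t :
  rev_matches (unzip1 t) (unzip2 t)
    + rev_matches (map negb (unzip1 t)) (map negb (unzip2 t)) = level_steps0 t.
Proof.
elim: t => //= -[x y] t IHt; rewrite !rev_matches_cons ?size_map //= -IHt ht_eq0.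
rewrite !count_id_map.
have := count_id_negb (unzip1 t); have := count_id_negb (unzip2 t).
rewrite !size_map; case: x y => -[] /=; lia.
Qed.

Lemma rev_boundary t :
  rev (map negb (boundary t)) = boundary [seq (xy.2, xy.1) | xy <- t].
Proof.
rewrite /boundary map_cat rev_cat /unzip1 /unzip2 -!map_comp map_rev revK -map_comp.
by congr (_ ++ _); rewrite ?map_rev -?map_comp //;
  apply: eq_map => -[x y] /=; rewrite ?negbK.
Qed.

Lemma matches_boundary t : ht t = 0%R ->
  matches (area_seq (boundary t)) (area_seq (rev (map negb (boundary t))))
  = level_steps0 t.
Proof.
move=> /eqP; rewrite ht_eq0 => /eqP cE; rewrite rev_boundary -rev_matches_level_steps0.
rewrite /boundary.
have [-> ->] : unzip1 [seq (xy.2, xy.1) | xy <- t] = unzip2 t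
    /\ unzip2 [seq (xy.2, xy.1) | xy <- t] = unzip1 t.
  by rewrite /unzip1 /unzip2 -!map_comp.
have : size (unzip1 t) = size (unzip2 t) by rewrite !size_map.
move: (unzip1 t) (unzip2 t) cE => a b cE szE.
(* Cut both sequences at the diagonal. The entries above it are shifted by [count id b] and
   [count id a], which agree at height 0. *)
rewrite !area_seq_cat matches_cat; last by rewrite !size_map !size_area_seq.
rewrite map_rev map_rev !count_rev !count_negb_map cE matches_map; last first.
  by move=> x y _ _ /addnI.
congr (_ + _).
  by rewrite /rev_matches matches_rev // !size_area_seq.
(* Below the diagonal the entries are complements to the common vertical count, which bounds them,
   so the truncated subtraction is injective. *)
rewrite !area_seq_rev_negb cE matchesC matches_map // => x y.
have := area_seq_le (map negb a); have := area_seq_le (map negb b).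
rewrite !count_negb_map !mem_rev -cE => /allP leb /allP lea /lea + /leb; lia.
Qed.

(** * Partitions in the square as walks ending at 0 *)

Definition shape_of (t : seq (bool * bool)) : seq nat :=
  [seq x <- area_seq (boundary t) | x != 0].

(** The zeros of a weakly decreasing sequence all stand at its end. *)
Lemma pad_filter s : sorted geq s -> pad (size s) [seq x <- s | x != 0] = s.
Proof.
elim: s => //= x s IHs; rewrite (path_sortedE (rev_trans leq_trans)).
case/andP=> sx /IHs {}IHs; case: eqP sx => [->|_] sx /=.
  have s0 : [seq x <- s | x != 0] = [::].
    apply/eqP; rewrite -[_ == _]negbK -has_filter -all_predC.
    by apply: sub_all sx => -[].
  by move: IHs; rewrite s0 /pad /= !subn0 /= => ->.
by rewrite /pad /= subSS -/(pad _ _) IHs.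
Qed.

Lemma filter_pad n la : 0 \notin la -> [seq x <- pad n la | x != 0] = la.
Proof.
move=> la0; rewrite filter_cat.
have -> : [seq x <- nseq (n - size la) 0 | x != 0] = [::] by elim: (n - _).
rewrite cats0; apply/all_filterP/allP => x xla.
by apply: contraNneq la0 => <-.
Qed.

Lemma size_boundary t : size (boundary t) = (size t).*2.
Proof. by rewrite size_cat size_map size_rev !size_map addnn. Qed.

Lemma count_boundary t : ht t = 0%R ->
  count id (boundary t) = size t /\ count negb (boundary t) = size t.
Proof.
move=> /eqP; rewrite ht_eq0 => /eqP cE; have := count_id_negb (boundary t).
rewrite size_boundary /boundary !count_cat count_id_map count_negb_map !count_rev.
have := count_id_negb (unzip2 t); rewrite size_map; lia.
Qed.

Lemma pad_shape_of t :
  ht t = 0%R -> pad (size t) (shape_of t) = area_seq (boundary t).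
Proof.
move=> /count_boundary[c1 _].
by rewrite -{1}c1 -size_area_seq pad_filter // area_seq_sorted.
Qed.

Lemma ds_square_shape_of t :
  ht t = 0%R -> ds_square (size t) (shape_of t) = level_steps0 t.
Proof.
move=> ht0; have [c1 c2] := count_boundary ht0.
have conjE : padded_conj (size t) (shape_of t)
    = area_seq (rev (map negb (boundary t))).
  by rewrite /padded_conj pad_shape_of // -c2 area_seq_conj.
rewrite /ds_square conjE pad_shape_of //.
rewrite (matchesE (n := size t)) ?matches_boundary ?size_area_seq //.
by rewrite count_rev count_id_map.
Qed.

Lemma shape_of_inj n :
  {in [pred t : n.-tuple (bool * bool) | ht t == 0%R] &,
    injective (fun t : n.-tuple _ => shape_of t)}.
Proof.
move=> t u /eqP ht0 /eqP hu0 E; apply: val_inj => /=.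
have szt := size_tuple t; have szu := size_tuple u.
have /area_seq_inj : area_seq (boundary t) = area_seq (boundary u).
  by rewrite -!pad_shape_of // szt szu E.
rewrite !size_boundary szt szu => /(_ erefl)/eqP; rewrite eqseq_cat; last first.
  by rewrite !size_map szt szu.
case/andP=> /eqP E1 /eqP /(inj_map negb_inj) /(can_inj revK) E2.
by rewrite -[val t]zip_unzip -[val u]zip_unzip E1 E2.
Qed.

Lemma shape_of_square n (t : n.-tuple (bool * bool)) : ht t = 0%R ->
  [&& is_partition (shape_of t), size (shape_of t) <= n & head 0 (shape_of t) <= n].
Proof.
move=> ht0; have [c1 c2] := count_boundary ht0; rewrite size_tuple in c1 c2.
have Kn := area_seq_le (boundary t); rewrite c2 in Kn.
apply/and3P; split.
- rewrite /is_partition mem_filter andbT.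
  by apply: sorted_filter (area_seq_sorted _); apply: rev_trans leq_trans.
- by rewrite size_filter -[leqRHS]c1 -size_area_seq count_size.
- have : all (fun x => x <= n) (shape_of t).
    by apply/allP => x; rewrite mem_filter => /andP[_ /(allP Kn)].
  by case: shape_of => //= x s /andP[].
Qed.

Lemma square_shape_of n la :
  [&& is_partition la, size la <= n & head 0 la <= n] ->
  exists2 t : n.-tuple (bool * bool), ht t = 0%R & shape_of t = la.
Proof.
case/and3P=> /andP[srt la0] szla hla.
have le_n : all (fun x => x <= n) (pad n la).
  rewrite all_cat all_nseq orbT andbT.
  case: la srt hla {la0 szla} => //= x s + xn; rewrite xn /=.
  move=> /(order_path_min (rev_trans leq_trans)).
  by apply: sub_all => y /leq_trans; apply.
have srt' : sorted geq (pad n la).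
  rewrite (sorted_pairwise (rev_trans leq_trans)) pairwise_cat.
  rewrite -!(sorted_pairwise (rev_trans leq_trans)) srt /=.
  apply/andP; split; last by elim: (n - _) => //= -[|k].
  by apply/allrelP => x y _ /nseqP[-> _].
have [w [c1 c2 Kw]] := area_seq_surj srt' le_n.
have szw : size w = n.*2.
  by rewrite -count_id_negb c1 c2 size_cat size_nseq subnKC // addnn.
have sz1 : size (take n w) = n by rewrite size_takel // szw -addnn leq_addr.
have sz2 : size (rev (map negb (drop n w))) = n.
  by rewrite size_rev size_map size_drop szw -addnn addnK.
(* The walk is [w] folded at its midpoint: the second half is reversed and complemented. *)
have szt : size (zip (take n w) (rev (map negb (drop n w)))) == n.
  by rewrite size_zip sz1 sz2 minnn.
have bE : boundary (Tuple szt) = w.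
  rewrite /boundary unzip1_zip ?sz1 ?sz2 // unzip2_zip ?sz1 ?sz2 // revK.
  by rewrite (mapK negbK) cat_take_drop.
exists (Tuple szt); last by rewrite /shape_of bE Kw filter_pad.
(* Since [w] has [n] vertical steps and its second half has length [n], that half has as many
   horizontal steps as the first half has vertical ones. *)
apply/eqP; rewrite ht_eq0 unzip1_zip ?sz1 ?sz2 // unzip2_zip ?sz1 ?sz2 //.
rewrite count_rev count_id_map.
have := count_id_negb (drop n w); have := c1.
rewrite -{1}(cat_take_drop n w) count_cat size_cat size_nseq subnKC // size_drop szw; lia.
Qed.

Local Open Scope ring_scope.

(** The two index types are compared through their images in [seq nat], which are duplicate-free and
    have the same members. *)
Lemma square_partitions_sum (V : nmodType) n (F : nat -> V) :
  \sum_(la in square_partitions n) F (ds_square n (square_parts la))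
  = \sum_(t : n.-tuple (bool * bool) | ht t == 0) F (level_steps0 t).
Proof.
have perm : perm_eq [seq square_parts la | la in square_partitions n]
                    [seq shape_of t | t : n.-tuple (bool * bool) in
                       [pred t : n.-tuple (bool * bool) | ht t == 0]].
  apply: uniq_perm.
  - by rewrite map_inj_uniq ?enum_uniq //; apply: square_parts_inj.
  - rewrite map_inj_in_uniq ?enum_uniq // => t u.
    by rewrite !mem_enum; apply: shape_of_inj.
  move=> la; apply/imageP/imageP => [[b Pb ->]|[t /eqP ht0 ->]].
    have /square_partitionsP/square_shape_of[t ht0 <-] :
      exists2 c, c \in square_partitions n & square_parts c = square_parts b.
      by exists b.
    by exists t => //; apply/eqP.
  by have /square_partitionsP[b Pb <-] := shape_of_square ht0; exists b.
transitivity (\sum_(la <- [seq square_parts la | la in square_partitions n])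
                F (ds_square n la)).
  by rewrite big_image.
rewrite (perm_big _ perm) /= big_image /=.
by apply: eq_bigr => t /eqP ht0; rewrite -(ds_square_shape_of ht0) size_tuple.
Qed.

(** * Recursion on the last step of a walk *)

Lemma sum_tuple_cons (V : nmodType) (T : finType) n (P : pred (n.+1.-tuple T))
    (F : n.+1.-tuple T -> V) :
  \sum_(t | P t) F t
  = \sum_x \sum_(t : n.-tuple T | P [tuple of x :: t]) F [tuple of x :: t].
Proof.
rewrite pair_big_dep /=; apply: reindex.
exists (fun t => (thead t, [tuple of behead t])) => [[x t] _|t _] /=.
  by congr (_, _); apply: val_inj.
by rewrite -tuple_eta.
Qed.

(** This is the coefficient of z^n in W_h, for heights of either sign. *)
Definition walk_sum (R : comNzRingType) (s : R) n (h : int) : R :=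
  \sum_(t : n.-tuple (bool * bool) | ht t == h) s ^+ level_steps0 t.

Lemma walk_sum0 (R : comNzRingType) (s : R) h : walk_sum s 0 h = (h == 0)%:R.
Proof.
rewrite /walk_sum big_mkcond (big_pred1 [tuple]) /=; last first.
  by move=> t; apply/esym/eqP/tuple0.
by rewrite [ht _]subrr eq_sym; case: eqP.
Qed.

Lemma walk_sumS (R : comNzRingType) (s : R) n h :
  walk_sum s n.+1 h = 2%:R * s ^+ (h == 0) * walk_sum s n h
                      + walk_sum s n (h - 1) + walk_sum s n (h + 1).
Proof.
(* [F x y] collects the walks with last step [(x, y)], which are at height [h - x + y] before it. *)
pose F (x y : bool) := s ^+ ((x == y) && (h == 0)) * walk_sum s n (h - x%:Z + y%:Z).
have step (xy : bool * bool) : \sum_(t : n.-tuple (bool * bool) | ht (xy :: t) == h)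
    s ^+ level_steps0 (xy :: t) = F xy.1 xy.2.
  case: xy => x y; rewrite /F mulr_sumr; apply: eq_big => [t|t /eqP <-].
    rewrite /ht /= !PoszD; apply/eqP/eqP; lia.
  rewrite /= exprD; case: (x =P y) => /= [->|_ //].
  by have -> : ht ((y, y) :: t) = ht t by rewrite /ht /= !PoszD; lia.
rewrite {1}/walk_sum sum_tuple_cons (eq_bigr _ (fun xy _ => step xy)).
rewrite -(pair_bigA _ F) /= !big_bool /F /= !expr0 !mul1r !subr0 subrK; ring.
Qed.

(** * Power series solving the recursion *)

Section FpsCoef.
Variable R : comNzRingType.
Implicit Types f g : fps R.

Lemma fps_coefXM f n :
  fps_coef (fpsX R * f) n = if n is m.+1 then fps_coef f m else 0.
Proof.
rewrite fps_coefM; case: n => [|n]; first by rewrite big_ord1 mul0r.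
rewrite 2!big_ord_recl big1 /= ?mul0r ?mul1r ?add0r ?addr0 ?subSS ?subn0 // => i _.
by rewrite mul0r.
Qed.

Lemma fps_coefCM c f n : fps_coef (fpsC c * f) n = c * fps_coef f n.
Proof.
by rewrite fps_coefM big_ord_recl subn0 big1 ?addr0 // => i _; rewrite mul0r.
Qed.

Lemma fpsXM_inj : injective (fun f : fps R => fpsX R * f).
Proof.
move=> f g; rewrite -[_ f]/(fpsX R * f) -[_ g]/(fpsX R * g) => E; apply: fpsP => n.
by rewrite -[LHS](fps_coefXM f n.+1) E fps_coefXM.
Qed.

(** The coefficients of G q^k obey the recursion of [walk_sum] with the same initial values; the
    absolute value reflects the symmetry between h and -h. *)
Lemma walk_sum_fps (s : R) (G q : fps R) n h :
    q = fpsX R * (1 + q) ^+ 2 ->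
    G = 1 + fpsX R * (2%:R * fpsC s * G + 2%:R * (G * q)) ->
  walk_sum s n h = fps_coef (G * q ^+ `|h|) n.
Proof.
move=> qE GE; pose c k m := fps_coef (G * q ^+ k) m.
have coef2M f m : fps_coef (2%:R * f) m = 2%:R * fps_coef f m.
  by rewrite mulr_natl fps_coefMn mulr_natl.
(* This is q = z (1 + q)^2 multiplied by G q^k. *)
have GqE k : G * q ^+ k.+1
    = fpsX R * (G * q ^+ k + 2%:R * (G * q ^+ k.+1) + G * q ^+ k.+2).
  by rewrite exprS {1}qE !exprS; ring.
have c00 : c 0%N 0%N = 1.
  by rewrite /c expr0 mulr1 GE fps_coefD fps_coefXM addr0.
have cS0 k : c k.+1 0%N = 0 by rewrite /c GqE fps_coefXM.
have c0S m : c 0%N m.+1 = 2%:R * s * c 0%N m + 2%:R * c 1%N m.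
  rewrite /c expr0 expr1 mulr1 {1}GE fps_coefD fps_coefXM fps_coefD fps_coef1.
  by rewrite -[2%:R * fpsC s * G]mulrA !coef2M fps_coefCM add0r mulrA.
have cSS k m : c k.+1 m.+1 = c k m + 2%:R * c k.+1 m + c k.+2 m.
  by rewrite {1}/c GqE fps_coefXM !fps_coefD coef2M.
rewrite -/(c `|h|%N n).
move: c c00 cS0 c0S cSS => c c00 cS0 c0S cSS.
elim: n h => [|n IHn] h.
  by rewrite walk_sum0; case: h => [[|k]|k]; rewrite ?c00 ?cS0.
rewrite walk_sumS !IHn; case: h => [[|k]|k].
- have [-> ->] : absz (Posz 0 - 1) = 1%N /\ absz (Posz 0 + 1) = 1%N by [].
  by rewrite c0S eqxx expr1; ring.
- have [-> ->] : absz (Posz k.+1 - 1) = k /\ absz (Posz k.+1 + 1) = k.+2 by lia.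
  by rewrite cSS expr0; ring.
- have [-> ->] : absz (Negz k - 1) = k.+2 /\ absz (Negz k + 1) = k by lia.
  by rewrite cSS expr0; ring.
Qed.

End FpsCoef.

(** * The Catalan series and the closed form *)

Section CatalanSeries.
Variable R : comUnitRingType.
Hypothesis unit2 : (2%:R : R) \is a GRing.unit.

Local Notation z := (fpsX R).
Local Notation r := (fps_sqrt (1 - 4%:R * z)).

(* C - 1 for the Catalan series C = (1 - sqrt (1 - 4 z)) / (2 z). *)
Definition catalan1 : fps R :=
  Fps (fun n => - (2%:R^-1 * fps_coef r n.+1) - (n == 0)%:R).

Lemma catalan1E : 2%:R * z * catalan1 = 1 - 2%:R * z - r.
Proof.
apply: fpsP => n; rewrite -mulrA !fps_coefB mulr_natl [2%:R * z]mulr_natl.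
rewrite !fps_coefMn fps_coefXM fps_coef1; case: n => [|n].
  (* The constant term of 1 - 2 z - r vanishes, so the index shift in [catalan1] is an exact
     division by z. *)
  by rewrite fps_sqrt_coef0 /= !mul0rn subr0 subrr.
have -> : fps_coef catalan1 n = - (2%:R^-1 * fps_coef r n.+1) - (n == 0)%:R by [].
rewrite [fps_coef z _]/= eqSS -[X in X = _]mulr_natl mulrBr mulrN mulVKr //.
by rewrite (mulr_natl (n == 0)%:R) sub0r addrC.
Qed.

Lemma sqr_sqrt_1B4z : r ^+ 2 = 1 - 4%:R * z.
Proof.
apply: fps_sqrtK => //.
by rewrite mulr_natl fps_coefB fps_coefMn /= mul0rn subr0.
Qed.

(** Multiplied by 4 z, the equation becomes 2 (1 - 2 z - r) = (1 - r)^2, that is, r^2 = 1 - 4 z. *)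
Lemma catalan1_quadratic : catalan1 = z * (1 + catalan1) ^+ 2.
Proof.
have unit4 : (4%:R : fps R) \is a GRing.unit.
  by rewrite fps_unitE fps_coefMn fps_coef1 (natrM _ 2 2) unitrM unit2.
apply: fpsXM_inj; apply: (mulrI unit4).
transitivity ((2%:R * z + 2%:R * z * catalan1) ^+ 2); last by ring.
transitivity (2%:R * (2%:R * z * catalan1)); first by ring.
have r2 := sqr_sqrt_1B4z; rewrite catalan1E.
transitivity (1 - 2%:R * r + r ^+ 2); last by ring.
by rewrite r2; ring.
Qed.

Lemma walk_sum_series (s : R) n h :
  walk_sum s n h = fps_coef ((2%:R * fpsC (1 - s) * z + r)^-1 * catalan1 ^+ `|h|) n.
Proof.
have unitD : 2%:R * fpsC (1 - s) * z + r \is a GRing.unit.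
  by rewrite fps_unitE fps_coefD fps_coefM big_ord1 /= mulr0 add0r unitr1.
apply: walk_sum_fps; first exact: catalan1_quadratic.
have CB : fpsC (1 - s) = 1 - fpsC s.
  by apply: fpsP => m; rewrite fps_coefB fps_coef1 /=; case: eqP; rewrite ?subr0.
move: unitD catalan1E; rewrite CB; move: (fps_sqrt _) => r.
move: catalan1 z => q x unitD qE.
(* The equation for G says G (1 - 2 s z - 2 z q) = 1, and the bracket is the denominator because 1 -
   2 z q = r + 2 z. Writing 1 as the denominator times its inverse leaves a polynomial identity. *)
rewrite -[X in _ = X + _](divrr unitD).
have rE : r = 1 - 2%:R * x - 2%:R * x * q by rewrite qE; ring.
rewrite {2}rE; ring.
Qed.

End CatalanSeries.

Theorem corollary4p2 :
  let s : {poly rat} := 'X in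
  let z : fps {poly rat} := fpsX {poly rat} in
  Fps (fun n => \sum_(la in square_partitions n)
                   s ^+ ds_square n (square_parts la))
  = 1 / (2%:R * fpsC (1 - s) * z + fps_sqrt (1 - 4%:R * z)).
Proof.
move=> s z; rewrite mul1r; apply: fpsP => n.
have := walk_sum_series polyrat2_unit s n 0; rewrite expr0 mulr1 => <-.
exact: (square_partitions_sum n (GRing.exp s)).
Qed.
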